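(* Let $A$ be a commutative ring, let $I$ be an ideal of $A$, and let $M$ be an $A$-module. Then $$\lim_{n\to\infty}\operatorname{grade}_{IA[X_1,\dots,X_n]}\bigl(M[X_1,\dots,X_n]\bigr)=\sup_B\,\operatorname{grade}_{IB}(M\otimes_A B),$$ where $B$ ranges over all faithfully flat (commutative) $A$-algebras.
   Context: All rings are commutative with identity. For a ring $R$ and an $R$-module $N$, a finite sequence $r_1,\dots,r_k\in R$ is a weak $N$-sequence if, for each $i$, the element $r_i$ is a non-zero-divisor on $N/(r_1,\dots,r_{i-1})N$ (every element is a non-zero-divisor on the zero module; it is not required that $N/(r_1,\dots,r_k)N\neq 0$). For an ideal $J\subset R$, $\operatorname{grade}_J(N)\in\{0,1,2,\dots\}\cup\{\infty\}$ denotes the supremum of the lengths of weak $N$-sequences contained in $J$. $M[X_1,\dots,X_n]$ denotes $M\otimes_A A[X_1,\dots,X_n]$ as an $A[X_1,\dots,X_n]$-module. The left-hand limit (taken in $\{0,1,2,\dots\}\cup\{\infty\}$; the sequence is nondecreasing in $n$) is called the polynomial grade of $M$ with respect to $I$. *)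

(* Defs.v *)
From HB Require Import structures.
From mathcomp Require Import all_boot all_order all_algebra.
From mathcomp Require Import finmap.
From mathcomp Require Import monalg.
From mathcomp Require Import boolp classical_sets reals ereal topology.
From mathcomp Require Import normedtype sequences.

Set Implicit Arguments.
Unset Strict Implicit.
Unset Printing Implicit Defensive.

Import Order.TTheory GRing.Theory Num.Theory.

Local Open Scope classical_set_scope.
Local Open Scope ring_scope.

(* Rings are [comPzRingType]s: unlike [comNzRingType], this includes the zero
   ring.  A [B]-algebra structure is given by its structure morphism. *)

Section Span.
Variable V : zmodType.

Definition is_subgroup (H : set V) :=
  H 0 /\ forall x y, H x -> H y -> H (x - y).

Definition span (S : set V) : {pred V} :=
  [pred x | `[< forall H, is_subgroup H -> S `<=` H -> H x >]].

Lemma spanP S x :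
  reflect (forall H, is_subgroup H -> S `<=` H -> H x) (x \in span S).
Proof. exact: asboolP. Qed.

Lemma mem_span (S : set V) x : S x -> x \in span S.
Proof. by move=> Sx; apply/spanP => H _; apply. Qed.

Lemma span_zmod_closed S : zmod_closed (span S).
Proof.
split=> [|x y /spanP Sx /spanP Sy]; apply/spanP => H Hsub SH.
  exact: Hsub.1.
by apply: Hsub.2; [apply: Sx | apply: Sy].
Qed.

HB.instance Definition _ S :=
  GRing.isZmodClosed.Build V (span S) (span_zmod_closed S).

Definition quot_span (S : set V) := Quotient.quot (span S).

HB.instance Definition _ S := GRing.Zmodule.on (quot_span S).

Definition quot_pi (S : set V) (x : V) : quot_span S :=
  (\pi_(Quotient.quot (span S)) x)%qT.

Lemma quot_pi_is_zmod S : zmod_morphism (quot_pi S).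
Proof. by move=> x y; rewrite /quot_pi !piE. Qed.

HB.instance Definition _ S :=
  GRing.isZmodMorphism.Build V (quot_span S) (quot_pi S) (quot_pi_is_zmod S).

Lemma quot_piP S x y : quot_pi S x = quot_pi S y <-> x - y \in span S.
Proof. by rewrite Quotient.idealrBE; split=> /eqP. Qed.

Lemma quot_piK S (t : quot_span S) : quot_pi S (repr t) = t.
Proof. exact: reprK. Qed.

End Span.

Section SpanLift.
Variables (V W : zmodType) (S : set V) (h : {additive V -> W}).
Hypothesis hS : forall x, S x -> h x = 0.

Definition quot_lift (t : quot_span S) : W := h (repr t).

Lemma quot_liftE x : quot_lift (quot_pi S x) = h x.
Proof.
have /spanP : repr (quot_pi S x) - x \in span S by apply/quot_piP/quot_piK.
move=> /(_ [set y | h y = 0]) /= H; apply/eqP; rewrite -subr_eq0 -raddfB H //.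
split=> [|y z /= hy hz]; rewrite /= ?raddf0 ?raddfB//.
by rewrite hy hz subr0.
Qed.

Lemma quot_lift_is_zmod : zmod_morphism quot_lift.
Proof.
move=> x y; rewrite -(quot_piK x) -(quot_piK y) -raddfB.
by rewrite 3!quot_liftE raddfB.
Qed.

End SpanLift.

Section Ideals.
Variable R : comPzRingType.

Definition is_ideal (J : set R) :=
  [/\ J 0, forall x y, J x -> J y -> J (x + y) & forall a x, J x -> J (a * x)].

Definition ideal_span (S : set R) : set R :=
  [set x | forall J, is_ideal J -> S `<=` J -> J x].

Lemma ideal_span_is_ideal S : is_ideal (ideal_span S).
Proof.
split=> [J [] //|x y Sx Sy J HJ SJ|a x Sx J HJ SJ].
  by have [_ JD _] := HJ; apply: JD; [apply: Sx | apply: Sy].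
by have [_ _ JM] := HJ; apply: JM; apply: Sx.
Qed.

End Ideals.

Section ModuleQuotient.
Variables (R : comPzRingType) (J : set R) (N : lmodType R).

Definition ideal_smul : set N := [set a *: x | a in J & x in [set: N]].

(* N / JN *)
Definition mod_quot := quot_span ideal_smul.

HB.instance Definition _ := GRing.Zmodule.on mod_quot.

Definition mod_pi : N -> mod_quot := quot_pi ideal_smul.

HB.instance Definition _ := GRing.Additive.on mod_pi.

Definition mod_quot_scale (a : R) : mod_quot -> mod_quot :=
  quot_lift (mod_pi \o ( *:%R a)).

Lemma mod_quot_scaleE a x : mod_quot_scale a (mod_pi x) = mod_pi (a *: x).
Proof.
apply: quot_liftE => _ [b Jb [y _ <-]] /=.
rewrite -(raddf0 mod_pi); apply/quot_piP; rewrite subr0 scalerA mulrC -scalerA.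
by apply/mem_span; exists b => //; exists (a *: y).
Qed.

Lemma mod_piK (t : mod_quot) : mod_pi (repr t) = t.
Proof. exact: quot_piK. Qed.

Fact mod_quot_scaleA a b t :
  mod_quot_scale a (mod_quot_scale b t) = mod_quot_scale (a * b) t.
Proof. by rewrite -[t]mod_piK !mod_quot_scaleE scalerA. Qed.

Fact mod_quot_scale1 : left_id 1 mod_quot_scale.
Proof. by move=> t; rewrite -[t]mod_piK mod_quot_scaleE scale1r. Qed.

Fact mod_quot_scaleDr : right_distributive mod_quot_scale +%R.
Proof.
move=> a t u; rewrite -[t]mod_piK -[u]mod_piK -raddfD !mod_quot_scaleE.
by rewrite scalerDr raddfD.
Qed.

Fact mod_quot_scaleDl t : {morph mod_quot_scale^~ t : a b / a + b}.
Proof.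
by move=> a b; rewrite -[t]mod_piK !mod_quot_scaleE scalerDl raddfD.
Qed.

HB.instance Definition _ := GRing.Zmodule_isLmodule.Build R mod_quot
  mod_quot_scaleA mod_quot_scale1 mod_quot_scaleDr mod_quot_scaleDl.

Lemma mod_pi_is_scalable : scalable mod_pi.
Proof. by move=> a x; rewrite -mod_quot_scaleE. Qed.

HB.instance Definition _ :=
  GRing.isScalable.Build R N mod_quot *:%R mod_pi mod_pi_is_scalable.

End ModuleQuotient.

Definition ext_ideal (A B : comPzRingType) (f : {rmorphism A -> B}) (I : set A) :
    set B :=
  ideal_span (f @` I).

Section Grade.
Variable R : comPzRingType.

Definition non_zero_divisor (N : lmodType R) (r : R) :=
  forall x : N, r *: x = 0 -> x = 0.

Variable N : lmodType R.

Definition weak_sequence (rs : seq R) :=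
  forall i, (i < size rs)%N ->
    non_zero_divisor (mod_quot (ideal_span [set` take i rs]) N) rs`_i.

(* Valued in the extended reals, where [0, 1, 2, ...] and [+oo] are closed
   under suprema and limits; the empty sequence makes the grade nonnegative. *)
Definition grade (K : realType) (J : set R) : \bar K :=
  ereal_sup [set (size rs)%:R%:E |
    rs in [set rs | weak_sequence rs /\ {in rs, forall r, J r}]].

End Grade.

Arguments grade {R} N K J.

(* [{malg int[K]}] is the free abelian group on [K]. *)
Section FreeLift.
Variables (K : choiceType) (V : zmodType) (h : K -> V).

Definition free_lift (g : {malg int[K]}) : V :=
  \sum_(k <- msupp g) h k *~ g@_k.

Lemma free_liftEw (d : {fset K}) g : (msupp g `<=` d)%fset ->
  free_lift g = \sum_(k <- d) h k *~ g@_k.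
Proof.
move=> le; rewrite [LHS](big_fset_incl _ le) => //= x xd /mcoeff_outdom ->.
by rewrite mulr0z.
Qed.

Lemma free_liftU k : free_lift << 1 *g k >> = h k.
Proof. by rewrite (free_liftEw msuppU_le) big_seq_fset1 mcoeffUU mulr1z. Qed.

Lemma free_lift_is_zmod : zmod_morphism free_lift.
Proof.
move=> g1 g2; set d := (msupp g1 `|` msupp g2)%fset.
rewrite (@free_liftEw d) ?msuppB_le// (@free_liftEw d g1) ?fsubsetUl//.
rewrite (@free_liftEw d g2) ?fsubsetUr// -sumrB; apply/eq_bigr => k _.
by rewrite raddfB /= mulrzBr.
Qed.

HB.instance Definition _ :=
  GRing.isZmodMorphism.Build {malg int[K]} V free_lift free_lift_is_zmod.

End FreeLift.

Section TensorProduct.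
Variables (A : comPzRingType) (M N : lmodType A).

Let gen (m : M) (n : N) : {malg int[(M * N)%type]} := << 1 *g (m, n) >>.

Inductive tensor_rel : {malg int[(M * N)%type]} -> Prop :=
| tensor_rel_addl m m' n : tensor_rel (gen (m + m') n - gen m n - gen m' n)
| tensor_rel_addr m n n' : tensor_rel (gen m (n + n') - gen m n - gen m n')
| tensor_rel_balanced a m n : tensor_rel (gen (a *: m) n - gen m (a *: n)).

Definition tensor := quot_span tensor_rel.

HB.instance Definition _ := GRing.Zmodule.on tensor.

Definition tens (m : M) (n : N) : tensor := quot_pi tensor_rel (gen m n).

Lemma tensDl m m' n : tens (m + m') n = tens m n + tens m' n.
Proof.
rewrite /tens -raddfD; apply/quot_piP; rewrite opprD addrA.
exact/mem_span/tensor_rel_addl.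
Qed.

Lemma tensDr m n n' : tens m (n + n') = tens m n + tens m n'.
Proof.
rewrite /tens -raddfD; apply/quot_piP; rewrite opprD addrA.
exact/mem_span/tensor_rel_addr.
Qed.

Lemma tens_balanced a m n : tens (a *: m) n = tens m (a *: n).
Proof. exact/quot_piP/mem_span/tensor_rel_balanced. Qed.

Lemma tensor_ext (V : zmodType) (h1 h2 : {additive tensor -> V}) :
  (forall m n, h1 (tens m n) = h2 (tens m n)) -> h1 =1 h2.
Proof.
move=> h12 t; rewrite -(quot_piK t) [repr t]monalgE !raddf_sum.
apply/eq_bigr => -[m n] _; set c := _@_ _.
have -> : << c *g (m, n) >> = gen m n *~ c.
  by apply/malgP => k; rewrite raddfMz /= !mcoeffU -mulrzl mulr_natr intz.
by rewrite !raddfMz; congr (_ *~ _); apply: h12.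
Qed.

Section Lift.
Variables (V : zmodType) (h : M -> N -> V).

Definition tensor_lift : tensor -> V :=
  quot_lift (free_lift (fun mn : M * N => h mn.1 mn.2)).

Hypothesis hDl : forall m m' n, h (m + m') n = h m n + h m' n.
Hypothesis hDr : forall m n n', h m (n + n') = h m n + h m n'.
Hypothesis hZ : forall a m n, h (a *: m) n = h m (a *: n).

Let hrel x : tensor_rel x -> free_lift (fun mn : M * N => h mn.1 mn.2) x = 0.
Proof.
case=> [m m' n|m n n'|a m n]; rewrite /gen !raddfB /=; rewrite ?free_liftU /=.
- by rewrite hDl -addrA -opprD subrr.
- by rewrite hDr -addrA -opprD subrr.
- by rewrite hZ subrr.
Qed.

Lemma tensor_liftE m n : tensor_lift (tens m n) = h m n.
Proof. by rewrite /tensor_lift (quot_liftE hrel); apply: free_liftU. Qed.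

Lemma tensor_lift_is_zmod : zmod_morphism tensor_lift.
Proof. exact: (quot_lift_is_zmod hrel). Qed.

End Lift.

End TensorProduct.

Section TensorMap.
Variables (A : comPzRingType) (M N M' N' : lmodType A).
Variables (g : {linear M -> M'}) (h : {linear N -> N'}).

Definition tensor_map : tensor M N -> tensor M' N' :=
  tensor_lift (fun m n => tens (g m) (h n)).

Let gDl m m' n : tens (g (m + m')) (h n) = tens (g m) (h n) + tens (g m') (h n).
Proof. by rewrite raddfD tensDl. Qed.

Let hDr m n n' : tens (g m) (h (n + n')) = tens (g m) (h n) + tens (g m) (h n').
Proof. by rewrite raddfD tensDr. Qed.

Let ghZ a m n : tens (g (a *: m)) (h n) = tens (g m) (h (a *: n)).
Proof. by rewrite !linearZ tens_balanced. Qed.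

Lemma tensor_mapE m n : tensor_map (tens m n) = tens (g m) (h n).
Proof. exact: (tensor_liftE gDl hDr ghZ). Qed.

Lemma tensor_map_is_zmod : zmod_morphism tensor_map.
Proof. exact: (tensor_lift_is_zmod gDl hDr ghZ). Qed.

HB.instance Definition _ := GRing.isZmodMorphism.Build
  (tensor M N) (tensor M' N') tensor_map tensor_map_is_zmod.

End TensorMap.

(* [B] as an [A]-module through [f] *)
Definition restr (A B : comPzRingType) (f : {rmorphism A -> B}) : Type := B.

Section RestrictScalars.
Variables (A B : comPzRingType) (f : {rmorphism A -> B}).

Local Notation restr := (restr f).

HB.instance Definition _ := GRing.Zmodule.on restr.

Let rscale (a : A) (b : restr) : restr := f a * (b : B).

Fact rscaleA a a' b : rscale a (rscale a' b) = rscale (a * a') b.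
Proof. by rewrite /rscale rmorphM mulrA. Qed.

Fact rscale1 : left_id 1 rscale.
Proof. by move=> b; rewrite /rscale rmorph1 mul1r. Qed.

Fact rscaleDr : right_distributive rscale +%R.
Proof. by move=> a b b'; rewrite /rscale mulrDr. Qed.

Fact rscaleDl b : {morph rscale^~ b : a a' / a + a'}.
Proof. by move=> a a'; rewrite /rscale rmorphD mulrDl. Qed.

HB.instance Definition _ := GRing.Zmodule_isLmodule.Build A restr
  rscaleA rscale1 rscaleDr rscaleDl.

Lemma restr_scaleE a (b : restr) : a *: b = f a * (b : B) :> B.
Proof. by []. Qed.

Definition restr_mul (b : B) : restr -> restr := fun c => b * (c : B).

Fact restr_mul_is_zmod b : zmod_morphism (restr_mul b).
Proof. by move=> c d; rewrite /restr_mul mulrBr. Qed.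

HB.instance Definition _ b := GRing.isZmodMorphism.Build
  restr restr (restr_mul b) (restr_mul_is_zmod b).

Fact restr_mul_is_scalable b : scalable (restr_mul b).
Proof. by move=> a c; rewrite /restr_mul !restr_scaleE mulrCA. Qed.

HB.instance Definition _ b := GRing.isScalable.Build
  A restr restr *:%R (restr_mul b) (restr_mul_is_scalable b).

End RestrictScalars.

Arguments restr_mul {A B} f b c.

Section BaseChange.
Variables (A B : comPzRingType) (f : {rmorphism A -> B}) (M : lmodType A).

(* M (x)_A B, a B-module through the second factor *)
Definition base_change := tensor M (restr f).

HB.instance Definition _ := GRing.Zmodule.on base_change.

Definition base_change_scale (b : B) : base_change -> base_change :=
  tensor_map idfun (restr_mul f b).

HB.instance Definition _ b := GRing.Additive.on (base_change_scale b).

Let scaleE b m c : base_change_scale b (tens m c) = tens m (restr_mul f b c).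
Proof. exact: tensor_mapE. Qed.

Fact base_change_scaleA b b' t :
  base_change_scale b (base_change_scale b' t) = base_change_scale (b * b') t.
Proof.
apply: (@tensor_ext _ _ _ _
  (base_change_scale b \o base_change_scale b') (base_change_scale _)).
by move=> m c /=; rewrite !scaleE /restr_mul mulrA.
Qed.

Fact base_change_scale1 : left_id 1 base_change_scale.
Proof.
apply: (@tensor_ext _ _ _ _ (base_change_scale 1) idfun) => m c /=.
by rewrite scaleE /restr_mul mul1r.
Qed.

Fact base_change_scaleDr : right_distributive base_change_scale +%R.
Proof. by move=> b t u; rewrite raddfD. Qed.

Fact base_change_scaleDl t : {morph base_change_scale^~ t : b b' / b + b'}.
Proof.
move=> b b'; apply: (@tensor_ext _ _ _ _ (base_change_scale (b + b'))
  (base_change_scale b \+ base_change_scale b')) => m c /=.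
by rewrite !scaleE -tensDr /restr_mul mulrDl.
Qed.

HB.instance Definition _ := GRing.Zmodule_isLmodule.Build B base_change
  base_change_scaleA base_change_scale1 base_change_scaleDr base_change_scaleDl.

Lemma base_change_scaleE b m (c : B) :
  b *: (tens m (c : restr f) : base_change) = tens m (b * c : restr f).
Proof. exact: scaleE. Qed.

End BaseChange.

Definition exact_at (X Y Z : zmodType) (g : X -> Y) (h : Y -> Z) :=
  forall y, h y = 0 <-> exists x, g x = y.

(* [- (x)_A B] preserves and reflects exactness.  Requiring [h \o g = 0] first
   would change nothing: a faithfully flat [f] also reflects zero maps. *)
Definition faithfully_flat (A B : comPzRingType) (f : {rmorphism A -> B}) :=
  forall (N1 N2 N3 : lmodType A) (g : {linear N1 -> N2}) (h : {linear N2 -> N3}),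
    exact_at g h <->
    exact_at (tensor_map g (idfun : {linear restr f -> restr f}))
             (tensor_map h (idfun : {linear restr f -> restr f})).

(* The library puts a ring structure on [{mpoly A[n]}] only for nonzero [A],
   so the alias [mpz] carries the same operations for arbitrary [A]. *)
Definition mpz (A : comPzRingType) (n : nat) := {mpoly A[n]}.

HB.instance Definition _ A n := GRing.Zmodule.on (mpz A n).

HB.lock Definition mpz_monom (A : comPzRingType) n (c : A) (k : 'X_{1..n}) : mpz A n :=
  << c *g k >>.

HB.lock Definition mpz_mul (A : comPzRingType) n (p q : mpz A n) : mpz A n :=
  \sum_(k1 <- msupp p) \sum_(k2 <- msupp q)
    mpz_monom (p@_k1 * q@_k2) (mmul k1 k2).

Section Polynomials.
Variables (A : comPzRingType) (n : nat).

Local Notation mpz := (mpz A n).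
Local Notation mpz_monom := (@mpz_monom A n).
Local Notation mpz_mul := (@mpz_mul A n).

Implicit Types (p q r : mpz) (c : A) (k : 'X_{1..n}).

(* The constant polynomials, i.e. the structure map of [A[X_1, ..., X_n]]. *)
Definition mpzC (c : A) : mpz := mpz_monom c mone.

Let monomD k c c' : mpz_monom (c + c') k = mpz_monom c k + mpz_monom c' k.
Proof. by rewrite unlock; apply: monalgUD. Qed.

Let monom0 k : mpz_monom 0 k = 0.
Proof. by rewrite unlock; apply: monalgU0. Qed.

Let mulEw (d1 d2 : {fset 'X_{1..n}}) p q :
  (msupp p `<=` d1)%fset -> (msupp q `<=` d2)%fset ->
  mpz_mul p q =
  \sum_(k1 <- d1) \sum_(k2 <- d2) mpz_monom (p@_k1 * q@_k2) (mmul k1 k2).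
Proof.
move=> le1 le2; rewrite mpz_mul.unlock (big_fset_incl _ le1) /=.
  apply/eq_bigr => k1 _; apply/big_fset_incl => // k _ /mcoeff_outdom ->.
  by rewrite mulr0 monom0.
move=> k _ /mcoeff_outdom pk.
by rewrite big1 // => k' _; rewrite pk mul0r monom0.
Qed.

Fact mpz_mulC : commutative mpz_mul.
Proof.
move=> p q; rewrite mpz_mul.unlock exchange_big; apply/eq_bigr => k _.
by apply/eq_bigr => k' _; rewrite mulrC mulmC.
Qed.

Fact mpz_mulDl : left_distributive mpz_mul +%R.
Proof.
move=> p q r; set d := (msupp p `|` msupp q)%fset.
rewrite (@mulEw d _ p r (fsubsetUl _ _) (fsubset_refl _)).
rewrite (@mulEw d _ q r (fsubsetUr _ _) (fsubset_refl _)).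
rewrite (@mulEw d _ (p + q) r (msuppD_le _ _) (fsubset_refl _)).
rewrite -big_split; apply/eq_bigr => k1 _.
rewrite -big_split; apply/eq_bigr => k2 _.
by rewrite mcoeffD mulrDl monomD.
Qed.

Let mulDr : right_distributive mpz_mul +%R.
Proof. by move=> p q r; rewrite mpz_mulC mpz_mulDl !(mpz_mulC p). Qed.

Lemma mpz_mulUU c c' k k' :
  mpz_mul (mpz_monom c k) (mpz_monom c' k') = mpz_monom (c * c') (mmul k k').
Proof.
rewrite (@mulEw [fset k]%fset [fset k']%fset _ _) ?big_seq_fset1 ?mpz_monom.unlock.
- by rewrite !mcoeffUU.
- exact: msuppU_le.
- exact: msuppU_le.
Qed.

Lemma mpzE p : p = \sum_(k <- msupp p) mpz_monom p@_k k.
Proof. by rewrite mpz_monom.unlock; apply: monalgE. Qed.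

Lemma mpz_ind (P : mpz -> Prop) :
  (forall c k, P (mpz_monom c k)) -> (forall p q, P p -> P q -> P (p + q)) ->
  forall p, P p.
Proof.
move=> Pmonom PD p; rewrite (mpzE p).
by apply: (big_ind P) => [|//|k _]; [rewrite -(monom0 mone); apply: Pmonom|].
Qed.

Fact mpz_mulA : associative mpz_mul.
Proof.
move=> p q r; elim/mpz_ind: p => [c1 k1|p p' IHp IHp']; last first.
  by rewrite !mpz_mulDl IHp IHp'.
elim/mpz_ind: q => [c2 k2|q q' IHq IHq']; last first.
  by rewrite mpz_mulDl !mulDr mpz_mulDl IHq IHq'.
elim/mpz_ind: r => [c3 k3|r r' IHr IHr']; last first.
  by rewrite !mulDr IHr IHr'.
by rewrite !mpz_mulUU mulrA mulmA.
Qed.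

Fact mpz_mul1 : left_id (mpzC 1) mpz_mul.
Proof.
elim/mpz_ind => [c k|p q IHp IHq]; last by rewrite mulDr IHp IHq.
by rewrite mpz_mulUU mul1r mul1m.
Qed.

HB.instance Definition _ := GRing.Zmodule_isComPzRing.Build mpz
  mpz_mulA mpz_mulC mpz_mul1 mpz_mulDl.

Fact mpzC_is_zmod : zmod_morphism mpzC.
Proof. by move=> c c'; rewrite /mpzC mpz_monom.unlock; apply: monalgUB. Qed.

HB.instance Definition _ :=
  GRing.isZmodMorphism.Build A mpz mpzC mpzC_is_zmod.

Fact mpzC_is_monoid : monoid_morphism mpzC.
Proof. by split=> // c c'; rewrite [RHS]mpz_mulUU mulm1. Qed.

HB.instance Definition _ :=
  GRing.isMonoidMorphism.Build A mpz mpzC mpzC_is_monoid.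

End Polynomials.

Lemma mpz_mulE (A : comNzRingType) n (p q : mpz A n) :
  p * q = (p : {mpoly A[n]}) * (q : {mpoly A[n]}).
Proof.
rewrite [LHS](_ : _ = mpz_mul p q) // mpz_mul.unlock mpz_monom.unlock.
exact: erefl.
Qed.

Arguments mpzC A n c : clear implicits.

(* Main.v *)
Require Import Defs.
From HB Require Import structures.
From mathcomp Require Import all_boot all_order all_algebra.
From mathcomp Require Import finmap monalg.
From mathcomp Require Import boolp classical_sets reals ereal topology.
From mathcomp Require Import normedtype sequences.

(* For b_1, ..., b_m in a ring R and an R-module N, let an i-cochain be an
   arbitrary N-valued function on i-tuples of indices, with differential
   (dc)(j, s) = b_j c(s) - d(c(j, .))(s).  The cohomology T^i(N) is a
   delta-functor with T^0(N) = {x | b_j x = 0 for all j}, and it is killed by the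
   ideal J generated by the b_j, since c |-> c(j, .) is a homotopy from b_j to 0.
   Hence, if r in J is regular on N, then T^i(N) = 0 for all i <= k if and only
   if T^i(N/rN) = 0 for all i < k.  So a weak N-sequence of length k in J forces
   T^i(N) = 0 for all i < k, and this vanishing is preserved and reflected by
   faithfully flat base change.
   Given a weak sequence of length k in IB, choose b_1, ..., b_m in I generating
   an ideal of B that contains it.  Then T^i vanishes for i < k on M (x) B,
   hence on M, hence on M[X_1, ..., X_n]; for n >= k the polynomials
   sum_j b_j X_v^j, v <= k, form a weak sequence there: each is regular modulo
   its predecessors by McCoy's theorem, T^0 of the quotient being 0.  Thus the
   grade over A[X_1, ..., X_n] is at least k as soon as n >= k, and it is at
   most the supremum because A[X_1, ..., X_n] is itself faithfully flat. *)

Set Implicit Arguments.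
Unset Strict Implicit.
Unset Printing Implicit Defensive.

Import Order.TTheory GRing.Theory Num.Theory.

Local Open Scope classical_set_scope.
Local Open Scope ring_scope.

(** * Cochains and weak sequences *)

Section Submodules.
Variables (R : comPzRingType) (N : lmodType R).
Implicit Types (U : set N) (r : R) (rs : seq R).

Definition submodule U := is_subgroup U /\ forall a x, U x -> U (a *: x).

Lemma submodule0 U : submodule U -> U 0.
Proof. by case=> -[]. Qed.

Lemma submoduleB U x y : submodule U -> U x -> U y -> U (x - y).
Proof. by case=> -[_ UB] _; apply: UB. Qed.

Lemma submoduleZ U a x : submodule U -> U x -> U (a *: x).
Proof. by case=> _; apply. Qed.

Lemma submoduleN U x : submodule U -> U x -> U (- x).
Proof.
by move=> subU Ux; rewrite -sub0r; apply: submoduleB => //; apply: submodule0.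
Qed.

Lemma submoduleD U x y : submodule U -> U x -> U y -> U (x + y).
Proof.
move=> subU Ux Uy; rewrite -[y]opprK; apply: submoduleB => //.
exact: submoduleN.
Qed.

Lemma submodule_sum U (I : Type) (s : seq I) (P : pred I) (F : I -> N) :
  submodule U -> (forall i, P i -> U (F i)) -> U (\sum_(i <- s | P i) F i).
Proof.
move=> subU UF; apply: (big_ind U) => //; first exact: submodule0.
by move=> x y; apply: submoduleD.
Qed.

Lemma submodule_zero : submodule [set 0].
Proof.
split=> [|a x /= ->]; last by rewrite scaler0.
by split=> // x y /= -> ->; rewrite subrr.
Qed.

(** The preimage in [N] of [r (N/U)]: successive quotients are tracked as growing submodules of the
    fixed module [N]. *)
Definition add_mul U r : set N := [set x + r *: y | x in U & y in [set: N]].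

Lemma add_mulP U r z :
  add_mul U r z <-> exists x y, U x /\ z = x + r *: y.
Proof.
split=> [[x Ux [y _ <-]]|[x [y [Ux ->]]]]; first by exists x, y.
by exists x => //; exists y.
Qed.

Lemma submodule_add_mul U r : submodule U -> submodule (add_mul U r).
Proof.
move=> subU; split=> [|a _ [x Ux [y _ <-]]]; last first.
  apply/add_mulP; exists (a *: x), (a *: y).
  by rewrite scalerDr !scalerA mulrC; split=> //; apply: submoduleZ.
split=> [|_ _ [x Ux [y _ <-]] [x' Ux' [y' _ <-]]]; apply/add_mulP.
  by exists 0, 0; rewrite scaler0 addr0; split=> //; apply: submodule0.
exists (x - x'), (y - y'); rewrite scalerBr opprD addrACA; split=> //.
exact: submoduleB.
Qed.

Definition seq_smul rs : set N :=
  [set x | x \in Defs.span (ideal_smul (ideal_span [set` rs]) (N:=N))].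

Lemma submodule_seq_smul rs : submodule (seq_smul rs).
Proof.
split=> [|a x /= /Defs.spanP Sx].
  by split=> [|x y]; rewrite /seq_smul /= ?rpred0//; apply: rpredB.
apply: (Sx [set y |
  a *: y \in Defs.span (ideal_smul (ideal_span [set` rs]) (N:=N))]).
  split=> [|y z] /=; first by rewrite scaler0 rpred0.
  by rewrite scalerBr; apply: rpredB.
move=> _ [r Jr [y _ <-]] /=; rewrite scalerA mulrC -scalerA.
by apply: Defs.mem_span; exists r => //; exists (a *: y).
Qed.

Lemma seq_smul_scale rs r x : r \in rs -> seq_smul rs (r *: x).
Proof.
move=> rsr; apply: Defs.mem_span; exists r; last by exists x.
by move=> J _; apply.
Qed.

(** The scalars carrying all of [N] into a subgroup [U] form an ideal. This is later applied to
    preimages under shift operators that are not linear over the polynomial ring. *)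
Lemma seq_smul_min rs U : is_subgroup U ->
  (forall r x, r \in rs -> U (r *: x)) -> seq_smul rs `<=` U.
Proof.
move=> subU Urs x /Defs.spanP; apply=> // _ [r Jr [y _ <-]].
apply: (Jr [set a | forall y, U (a *: y)]) y.
  split=> [y|a a' Ua Ua' y|a a' Ua y] /=.
  - by rewrite scale0r; apply: subU.1.
  - rewrite scalerDl -[a' *: y]opprK -[- (a' *: y)]sub0r.
    by apply: subU.2 (Ua y) _; apply: subU.2 subU.1 (Ua' y).
  - by rewrite mulrC -scalerA; apply: Ua.
by move=> s /= /Urs.
Qed.

Lemma seq_smul_nil : seq_smul [::] = [set 0].
Proof.
rewrite eqEsubset; split.
  by apply: seq_smul_min; first exact: submodule_zero.1.
by move=> _ ->; apply: submodule0; apply: submodule_seq_smul.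
Qed.

Lemma seq_smul_rcons rs r : seq_smul (rcons rs r) = add_mul (seq_smul rs) r.
Proof.
have subV := submodule_seq_smul rs.
rewrite eqEsubset; split.
  apply: seq_smul_min => [|a x]; first exact: (submodule_add_mul _ _).1.
  rewrite mem_rcons inE => /predU1P[->|rsa]; apply/add_mulP.
    by exists 0, x; rewrite add0r; split=> //; apply: submodule0.
  by exists (a *: x), 0; rewrite scaler0 addr0; split=> //; apply: seq_smul_scale.
have subV' := submodule_seq_smul (rcons rs r).
move=> _ [x Vx [y _ <-]]; apply: submoduleD => //; last first.
  by apply: seq_smul_scale; rewrite mem_rcons mem_head.
apply: seq_smul_min Vx => [|a z rsa]; first exact: subV'.1.
apply: seq_smul_scale.
by rewrite mem_rcons inE rsa orbT.
Qed.

Definition regular_mod U r := forall x, U (r *: x) -> U x.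

Lemma weak_sequenceP rs : weak_sequence N rs <->
  forall v, (v < size rs)%N -> regular_mod (seq_smul (take v rs)) rs`_v.
Proof.
have pi0 J x : @mod_pi R J N x = 0 <-> x \in Defs.span (ideal_smul J (N:=N)).
  by have := quot_piP (ideal_smul J (N:=N)) x 0; rewrite subr0 raddf0.
split=> wrs v /wrs => [nzd x Vx|reg t].
  by apply/pi0/nzd; rewrite -linearZ; apply/pi0.
by rewrite -[t]mod_piK -linearZ => /pi0/reg Vx; apply/pi0.
Qed.

End Submodules.

Arguments seq_smul {R} N rs.

(** * Cohomology of the cochain complex and dimension shifting *)

Section Cochains.
Variables (R : comPzRingType) (N : lmodType R) (T : Type) (b : T -> R).
Implicit Types (c e : seq T -> N) (s : seq T) (U : set N) (r : R) (rs : seq R).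

(* Read on sequences of size [i], [c] is an [i]-cochain; unfolding the
   recursion gives the alternating sum of the [b s_l *: c (s minus s_l)]. *)
Fixpoint cobound c s : N :=
  if s is j :: s' then b j *: c s' - cobound (fun t => c (j :: t)) s' else 0.

Lemma coboundB c e s :
  cobound (fun t => c t - e t) s = cobound c s - cobound e s.
Proof.
elim: s c e => [|j s IHs] c e /=; first by rewrite subrr.
by rewrite IHs scalerBr opprD addrACA -opprD.
Qed.

Lemma coboundZ a c s : cobound (fun t => a *: c t) s = a *: cobound c s.
Proof.
elim: s c => [|j s IHs] c /=; first by rewrite scaler0.
by rewrite IHs scalerBr !scalerA mulrC.
Qed.

Lemma cobound_cobound c s : cobound (cobound c) s = 0.
Proof.
elim: s c => [//|j s IHs] c /=.
by rewrite coboundB coboundZ IHs subr0 subrr.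
Qed.

Lemma cobound_sub U i c : submodule U ->
  (forall s, size s = i -> U (c s)) ->
  forall s, size s = i.+1 -> U (cobound c s).
Proof.
move=> subU Uc s; elim: s i c Uc => [//|j s IHs] [|i] c Uc /= [si].
  by case: s si {IHs} => //= _; rewrite subr0; apply: submoduleZ; last exact: Uc.
apply: submoduleB => //; first by apply: submoduleZ; last exact: Uc.
by apply: IHs si => t ti; apply: Uc => /=; rewrite ti.
Qed.

(** For a submodule [U] this is [T^i(N/U) = 0], phrased by congruences between [N]-valued cochains.
    In degree 0 there are no coboundaries, as [cobound e] vanishes on [[::]]. *)
Definition acyclic U i := forall c,
  (forall s, size s = i.+1 -> U (cobound c s)) ->
  exists e, forall s, size s = i -> U (c s - cobound e s).

(** The scalars [a] for which [a *: c] is a coboundary modulo [U] form an ideal. It contains [b j],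
    because the difference of [b j *: c s] and the coboundary of [c (j :: _)] at [s] is by
    definition [cobound c (j :: s)]. *)
Lemma ideal_homotopy U i c r : submodule U -> ideal_span (range b) r ->
  (forall s, size s = i.+1 -> U (cobound c s)) ->
  exists e, forall s, size s = i -> U (r *: c s - cobound e s).
Proof.
move=> subU Jr Uc; apply: (Jr [set a |
    exists e, forall s, size s = i -> U (a *: c s - cobound e s)]).
  split=> /= [|a a' [e Ue] [e' Ue']|a a' [e Ue]].
  - exists (fun=> 0) => s si; rewrite scale0r sub0r; apply: submoduleN => //.
    case: s si => [|j s] _; first exact: submodule0.
    by apply: (@cobound_sub U (size s)) => // *; apply: submodule0.
  - exists (fun t => e t - (-1 *: e' t)) => s si.
    rewrite coboundB coboundZ scaleN1r opprK scalerDl opprD addrACA.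
    by apply: submoduleD => //; [apply: Ue | apply: Ue'].
  - exists (fun t => a *: e t) => s si; rewrite coboundZ -scalerA -scalerBr.
    by apply: submoduleZ; last exact: Ue.
move=> _ [j _ <-] /=; exists (fun t => c (j :: t)) => s si.
by apply: (Uc (j :: s)); rewrite /= si.
Qed.

Lemma acyclic0 U :
  acyclic U 0 <-> forall x, (forall j, U (b j *: x)) -> U x.
Proof.
split=> [acU x Ux|Ux c Uc].
  have [|e /(_ [::] erefl)] := acU (fun=> x); last by rewrite subr0.
  by move=> [|j []] //= _; rewrite subr0.
exists c => -[]//= _; rewrite subr0; apply: Ux => j.
by have := Uc [:: j] erefl; rewrite /= subr0.
Qed.

Lemma acyclic0_regular U r : submodule U -> ideal_span (range b) r ->
  regular_mod U r -> acyclic U 0.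
Proof.
move=> subU Jr regr c Uc; exists c => s s0; rewrite (size0nil s0) subr0.
have [e /(_ [::] erefl)] := ideal_homotopy subU Jr Uc.
by rewrite subr0 => /regr.
Qed.

(** Since [r] kills cohomology, [r c] is a coboundary [d e0] modulo [U]. Then [e0] is a cocycle
    modulo [U + rN], hence of the form [d e' + r e1] modulo [U], and cancelling [r] in
    [r c = r d e1] gives [c = d e1]. *)
Lemma acyclic_regularS U r i : submodule U -> ideal_span (range b) r ->
  regular_mod U r -> acyclic (add_mul U r) i -> acyclic U i.+1.
Proof.
move=> subU Jr regr acU c Uc.
have [e0 Ue0] := ideal_homotopy subU Jr Uc.
have [s si|e' Ue'] := acU e0.
  apply/add_mulP; exists (- (r *: c s - cobound e0 s)), (c s).
  rewrite opprB subrK; split=> //; rewrite -opprB.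
  by apply: submoduleN; last exact: Ue0.
(* Only sequences of size [i] matter; [e1] may take the value 0 elsewhere. *)
have /choice[e1 Ue1] s :
    exists y, size s = i -> U (e0 s - cobound e' s - r *: y).
  have [si|si] := pselect (size s = i); last by exists 0.
  have [x [y [Ux ->]]] := (add_mulP _ _ _).1 (Ue' s si).
  by exists y; rewrite addrK.
exists e1 => s si; apply: regr; rewrite scalerBr -coboundZ.
have := submoduleD subU (Ue0 s si) (cobound_sub subU Ue1 si).
by rewrite !coboundB cobound_cobound subr0 addrA subrK.
Qed.

(** This is exactness of [T^i(N/U) -> T^i(N/(U + rN)) -> T^(i+1)(N/U)] at the middle. Modulo [U],
    write [d c = r e]; regularity makes [e] a cocycle, so [e = d g]; then [c - r g] is a cocycle, so
    it equals some [d h]. *)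
Lemma acyclic_quotient U r i : submodule U -> regular_mod U r ->
  acyclic U i -> acyclic U i.+1 -> acyclic (add_mul U r) i.
Proof.
move=> subU regr acU acUS c Uc.
have /choice[e Ue] s : exists y, size s = i.+1 -> U (cobound c s - r *: y).
  have [si|si] := pselect (size s = i.+1); last by exists 0.
  have [x [y [Ux ->]]] := (add_mulP _ _ _).1 (Uc s si).
  by exists y; rewrite addrK.
have [s si|g Ug] := acUS e.
  apply: regr; rewrite -coboundZ.
  have := submoduleN subU (cobound_sub subU Ue si).
  by rewrite coboundB cobound_cobound sub0r opprK.
have [s si|h Uh] := acU (fun t => c t - r *: g t).
  rewrite coboundB coboundZ.
  have := submoduleD subU (Ue s si) (submoduleZ r subU (Ug s si)).
  by rewrite scalerBr addrA subrK.
exists h => s si; apply/add_mulP; exists (c s - r *: g s - cobound h s), (g s).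
by split; [apply: Uh | rewrite [RHS]addrAC subrK].
Qed.

Lemma weak_sequence_acyclic rs i :
  weak_sequence N rs -> {in rs, forall r, ideal_span (range b) r} ->
  (i < size rs)%N -> acyclic [set 0] i.
Proof.
move=> /weak_sequenceP wrs Jrs.
(* Passing to the quotient by one more element lowers the degree by one, so the induction runs along
   constant [i + v] down to degree 0. *)
suff ac v : (i + v < size rs)%N -> acyclic (seq_smul N (take v rs)) i.
  by have := ac 0%N; rewrite addn0 take0 seq_smul_nil.
elim: i v => [|i IHi] v lt_v.
  apply: (acyclic0_regular _ _ (wrs v lt_v)); first exact: submodule_seq_smul.
  by apply: Jrs; apply: mem_nth.
have lt_v' : (v < size rs)%N by apply: leq_trans lt_v; rewrite ltnS leq_addl.
apply: (acyclic_regularS _ _ (wrs v lt_v')); first exact: submodule_seq_smul.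
  by apply: Jrs; apply: mem_nth.
by rewrite -seq_smul_rcons -take_nth//; apply: IHi; rewrite addnS -addSn.
Qed.

(** Vanishing in degrees below [size rs - v] modulo the first [v] elements includes degree 0, which
    makes the next element regular; [acyclic_quotient] then gives the vanishing in one degree fewer
    modulo that element too. *)
Lemma acyclic_weak_sequence rs :
  (forall v, (v < size rs)%N -> acyclic (seq_smul N (take v rs)) 0 ->
    regular_mod (seq_smul N (take v rs)) rs`_v) ->
  (forall i, (i < size rs)%N -> acyclic [set 0] i) ->
  weak_sequence N rs.
Proof.
move=> reg ac0; apply/weak_sequenceP.
suff ac v i : (i + v < size rs)%N -> acyclic (seq_smul N (take v rs)) i.
  by move=> v lt_v; apply: reg; last apply: ac.
elim: v i => [|v IHv] i; first by rewrite addn0 take0 seq_smul_nil; apply: ac0.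
move=> lt_iv.
have lt_v : (v < size rs)%N.
  by apply: leq_ltn_trans lt_iv; rewrite addnS leqW ?leq_addl.
rewrite (take_nth 0)// seq_smul_rcons; apply: acyclic_quotient.
- exact: submodule_seq_smul.
- by apply: (reg _ lt_v); apply: IHv; rewrite add0n.
- by apply: IHv; apply: ltn_trans lt_iv; rewrite addnS.
- by apply: IHv; rewrite addSn -addnS.
Qed.

End Cochains.

(** * Faithfully flat descent *)

Lemma tens0l (A : comPzRingType) (M N : lmodType A) (n : N) :
  tens (0 : M) n = 0.
Proof. by apply: (addIr (tens 0 n)); rewrite -tensDl !add0r. Qed.

Lemma tens0r (A : comPzRingType) (M N : lmodType A) (m : M) :
  tens m (0 : N) = 0.
Proof. by apply: (addIr (tens m 0)); rewrite -tensDr !add0r. Qed.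

Lemma tensBl (A : comPzRingType) (M N : lmodType A) (m m' : M) (n : N) :
  tens (m - m') n = tens m n - tens m' n.
Proof. by apply: (addIr (tens m' n)); rewrite -tensDl !subrK. Qed.

(** The projection modulo the subgroup [P] is zero on pure tensors, hence zero by [tensor_ext]. *)
Lemma tensor_ind (A : comPzRingType) (M N : lmodType A) 
    (P : tensor M N -> Prop) :
  P 0 -> (forall t u, P t -> P u -> P (t - u)) -> (forall m n, P (tens m n)) ->
  forall t, P t.
Proof.
move=> P0 PB Ptens t.
have /quot_piP : quot_pi P t = quot_pi P 0.
  rewrite raddf0; apply: (@tensor_ext _ _ _ _ (quot_pi P) \0) => m n.
  transitivity (quot_pi P 0); last exact: raddf0.
  by apply/quot_piP; rewrite subr0; apply: Defs.mem_span.
by rewrite subr0 => /Defs.spanP; apply.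
Qed.

Lemma exact_at_iso (X Y Z X' Y' Z' : zmodType) (g : X -> Y) (h : Y -> Z)
    (g' : X' -> Y') (h' : Y' -> Z') (u : X -> X') (v : Y -> Y')
    (w : {additive Z -> Z'}) :
  bijective u -> bijective v -> injective w ->
  (forall x, v (g x) = g' (u x)) -> (forall y, w (h y) = h' (v y)) ->
  exact_at g h <-> exact_at g' h'.
Proof.
case=> u' uK u'K [v' vK v'K] w_inj vg wh; split=> ex y.
  rewrite -(v'K y) -wh; split.
    rewrite -(raddf0 w) => /w_inj/ex[x <-].
    by exists (u x); rewrite -vg.
  case=> x; rewrite -(u'K x) -vg => /(can_inj vK) gx.
  by rewrite (ex _).2 ?raddf0//; exists (u' x).
split=> [hy|[x gx]]; last first.
  by apply: w_inj; rewrite wh raddf0; apply/ex; exists (u x); rewrite -vg gx.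
have /ex[x gx] : h' (v y) = 0 by rewrite -wh hy raddf0.
by exists (u' x); apply: (can_inj vK); rewrite vg u'K.
Qed.

Section TupleCochains.
Variables (R : comPzRingType) (N : lmodType R) (T : finType) (b : T -> R).

(** Faithful flatness concerns modules, so [i]-cochains become finite functions on [i]-tuples.
    Extending them by 0 is harmless: by [eq_cobound], [cobound] at a sequence of size [i.+1] only
    evaluates its argument at size [i]. *)
Definition tuple_ext i (c : i.-tuple T -> N) (s : seq T) : N :=
  if insub s is Some t then c t else 0.

Lemma tuple_extE i (c : i.-tuple T -> N) (t : i.-tuple T) : tuple_ext c t = c t.
Proof. by rewrite /tuple_ext valK. Qed.

Lemma eq_cobound i (c c' : seq T -> N) s : size s = i ->
  (forall t, (size t).+1 = i -> c t = c' t) -> cobound b c s = cobound b c' s.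
Proof.
elim: s i c c' => [//|j s IHs] _ c c' /= <- eq_c; rewrite eq_c//.
by congr (_ - _); apply: (IHs (size s)) => // t ts; apply: eq_c; rewrite /= ts.
Qed.

(** The two degrees are independent parameters so that the incoming map from degree [i.-1] to degree
    [i] also makes sense for [i = 0]. *)
Definition tuple_cobound i j (c : {ffun i.-tuple T -> N}) :
  {ffun j.-tuple T -> N} := [ffun s : j.-tuple T => cobound b (tuple_ext c) s].

Fact tuple_cobound_is_zmod i j : zmod_morphism (@tuple_cobound i j).
Proof.
move=> c e; apply/ffunP => s; rewrite !ffunE -coboundB.
apply: (@eq_cobound j) => [|t _]; first exact: size_tuple.
by rewrite /tuple_ext; case: insubP => [u _ _|_]; rewrite ?ffunE ?subrr.
Qed.

HB.instance Definition _ i j := GRing.isZmodMorphism.Build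
  {ffun i.-tuple T -> N} {ffun j.-tuple T -> N} (@tuple_cobound i j)
  (@tuple_cobound_is_zmod i j).

Fact tuple_cobound_is_scalable i j : scalable (@tuple_cobound i j).
Proof.
move=> a c; apply/ffunP => s; rewrite !ffunE -coboundZ.
apply: (@eq_cobound j) => [|t _]; first exact: size_tuple.
by rewrite /tuple_ext; case: insubP => [u _ _|_]; rewrite ?ffunE ?scaler0.
Qed.

HB.instance Definition _ i j := GRing.isScalable.Build R
  {ffun i.-tuple T -> N} {ffun j.-tuple T -> N} *:%R (@tuple_cobound i j)
  (@tuple_cobound_is_scalable i j).

(* For [i = 0] the first map is zero, since [cobound] vanishes on [[::]]. *)
Lemma acyclic_exact i : acyclic b [set 0 : N] i <->
  exact_at (@tuple_cobound i.-1 i) (@tuple_cobound i i.+1).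
Proof.
have extK (c : seq T -> N) j s : size s = j ->
    tuple_ext [ffun t : j.-tuple T => c t] s = c s.
  by move=> sj; rewrite -[s]/(val (Tuple (introT eqP sj))) tuple_extE ffunE.
have predK (t s : seq T) : size s = i -> (size t).+1 = size s -> size t = i.-1.
  by move=> <- <-.
split=> [ac c|ex c c0].
  split=> [c0|[e <-]].
    have [s si|e ce] := ac (tuple_ext c).
      rewrite -[s]/(val (Tuple (introT eqP si))).
      by have /ffunP/(_ (Tuple (introT eqP si))) := c0; rewrite !ffunE.
    exists [ffun t : i.-1.-tuple T => e t]; apply/ffunP => s; rewrite ffunE.
    have := ce s (size_tuple s); rewrite tuple_extE => /eqP; rewrite subr_eq0.
    move=> /eqP ->; apply: (@eq_cobound (size s)) => // t ts.
    by apply: extK; apply: predK ts; apply: size_tuple.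
  apply/ffunP => s; rewrite !ffunE.
  rewrite -[RHS](@cobound_cobound _ _ _ b (tuple_ext e) s).
  apply: (@eq_cobound i.+1) => [|t [ti]]; first exact: size_tuple.
  by rewrite -[t]/(val (Tuple (introT eqP ti))) tuple_extE ffunE.
have [|e ce] := (ex [ffun t : i.-tuple T => c t]).1 _.
  apply/ffunP => s; rewrite !ffunE -[RHS](c0 s (size_tuple s)).
  by apply: (@eq_cobound i.+1) => [|t [ti]]; [apply: size_tuple | apply: extK].
exists (tuple_ext e) => s si.
move/ffunP/(_ (Tuple (introT eqP si))): ce; rewrite !ffunE /= => ->.
by rewrite subrr.
Qed.

End TupleCochains.

Section FiniteProduct.
Variables (A B : comPzRingType) (f : {rmorphism A -> B}) (M : lmodType A).
Variable F : finType.

Definition ffun_eval (s : F) (c : {ffun F -> M}) : M := c s.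

Fact ffun_eval_is_linear s : linear (ffun_eval s).
Proof. by move=> a c e; rewrite /ffun_eval !ffunE. Qed.

HB.instance Definition _ s :=
  GRing.isLinear.Build A _ _ _ (ffun_eval s) (ffun_eval_is_linear s).

Definition ffun_delta (s : F) (m : M) : {ffun F -> M} :=
  [ffun s' => if s' == s then m else 0].

Fact ffun_delta_is_linear s : linear (ffun_delta s).
Proof.
move=> a c e; apply/ffunP => s'; rewrite !ffunE.
by case: ifP => // _; rewrite scaler0 addr0.
Qed.

HB.instance Definition _ s :=
  GRing.isLinear.Build A _ _ _ (ffun_delta s) (ffun_delta_is_linear s).

Local Notation tensorB N := (tensor N (restr f)).

Definition tensor_ffun (t : tensorB {ffun F -> M}) :
    {ffun F -> base_change f M} :=
  [ffun s => tensor_map (ffun_eval s) idfun t].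

Lemma tensor_ffunE c d s :
  tensor_ffun (tens c d) s = tens (c s) d :> tensorB M.
Proof. by rewrite ffunE tensor_mapE. Qed.

Fact tensor_ffun_is_zmod : zmod_morphism tensor_ffun.
Proof. by move=> t u; apply/ffunP => s; rewrite !ffunE raddfB. Qed.

HB.instance Definition _ := GRing.isZmodMorphism.Build
  (tensorB {ffun F -> M}) {ffun F -> base_change f M} tensor_ffun
  tensor_ffun_is_zmod.

(** Tensor products commute with finite direct sums: the inverse adds up the images of the
    components under the coordinate inclusions [ffun_delta s]. *)
Lemma tensor_ffun_bij : bijective tensor_ffun.
Proof.
exists (fun g : {ffun F -> base_change f M} =>
    \sum_s tensor_map (ffun_delta s) idfun (g s)) => [t|g].
  elim/tensor_ind: t => [|t u IHt IHu|c d].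
  - by rewrite big1 => [//|s _]; rewrite ffunE !raddf0.
  - rewrite -[in RHS]IHt -[in RHS]IHu -sumrB; apply: eq_bigr => s _.
    by rewrite !ffunE !raddfB.
  transitivity (\sum_s tens (ffun_delta s (c s)) (d : restr f)).
    by apply: eq_bigr => s _; rewrite ffunE !tensor_mapE.
  have -> : tens c d = (fun c' => tens c' d) (\sum_s ffun_delta s (c s)).
    congr (tens _ _); apply/ffunP => s; rewrite sum_ffunE (bigD1 s)//= ffunE eqxx.
    by rewrite big1 ?addr0// => s' /negPf ns; rewrite ffunE eq_sym ns.
  elim/big_rec2: _ => [|s x y _ ->] /=; last by rewrite tensDl.
  by rewrite tens0l.
apply/ffunP => s; rewrite ffunE raddf_sum (bigD1 s)//=.
have ed s' (t : tensorB M) : tensor_map (ffun_eval s) idfun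
    (tensor_map (ffun_delta s') idfun t) = if s == s' then t else 0.
  elim/tensor_ind: t => [|t u IHt IHu|m d].
  - by rewrite !raddf0; case: ifP.
  - by rewrite !raddfB /= IHt IHu; case: ifP => //; rewrite subr0.
  - by rewrite !tensor_mapE /= /ffun_eval ffunE; case: ifP => // _; rewrite tens0l.
rewrite ed eqxx big1 ?addr0// => s' /negPf ns.
by rewrite ed eq_sym ns.
Qed.

End FiniteProduct.

Section Descent.
Variables (A B : comPzRingType) (f : {rmorphism A -> B}) (M : lmodType A).
Variables (T : finType) (b : T -> A).

Lemma base_change_cobound (c : seq T -> M) (d : restr f) s :
  cobound (f \o b) (fun t => tens (c t) d : base_change f M) s =
  tens (cobound b c s) d.
Proof.
elim: s c => [|j s IHs] c /=.
  by rewrite tens0l.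
by rewrite IHs base_change_scaleE tensBl tens_balanced.
Qed.

Lemma tensor_ffun_cobound i j (t : tensor {ffun i.-tuple T -> M} (restr f)) :
  tensor_ffun (tensor_map (tuple_cobound b j) idfun t) =
  tuple_cobound (f \o b) j (tensor_ffun t).
Proof.
apply: (@tensor_ext _ _ _ _
  (@tensor_ffun _ _ f M _ \o tensor_map (tuple_cobound b j) idfun)
  (tuple_cobound (f \o b) j \o @tensor_ffun _ _ f M _) _ t) => c d /=.
apply/ffunP => s; rewrite tensor_mapE tensor_ffunE !ffunE -base_change_cobound.
apply: (@eq_cobound _ _ _ _ j) => [|u _]; first exact: size_tuple.
rewrite /tuple_ext; case: insubP => [v _ _|_]; first by rewrite tensor_ffunE.
by rewrite tens0l.
Qed.

(** As [T] is finite, [tensor_ffun] identifies the cochain complex of [M] tensored with [B] with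
    that of [base_change f M], and acyclicity is exactness at one spot. *)
Lemma acyclic_base_change i : faithfully_flat f ->
  acyclic b [set 0 : M] i <-> acyclic (f \o b) [set 0 : base_change f M] i.
Proof.
move=> flatf; rewrite !acyclic_exact flatf.
apply: exact_at_iso (tensor_ffun_bij f M _) (tensor_ffun_bij f M _) _ _ _.
- exact/bij_inj/tensor_ffun_bij.
- exact: tensor_ffun_cobound.
- exact: tensor_ffun_cobound.
Qed.

End Descent.

(** * Polynomial weak sequences *)

Section McCoy.
Variables (R : comPzRingType) (N : lmodType R) (U : set N) (X : R).
(** [sigma] abstracts division by [X] that discards the terms free of [X]; the vanishing of
    [iter d sigma x] replaces the condition that [x] has degree less than [d] in [X]. *)
Variables (sigma : {additive N -> N}) (m : nat) (b : 'I_m -> R).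
Hypotheses (subU : submodule U) (sigmaU : forall x, U x -> U (sigma x)).
Hypothesis sigmaK : forall x, sigma (X *: x) = x.
Hypothesis sigmaZ : forall j x, sigma (b j *: x) = b j *: sigma x.
Hypothesis sigma_nil : forall x, exists d, iter d sigma x = 0.

Let iter_add d : {morph iter d sigma : x y / x + y}.
Proof. by elim: d => [//|d IHd] x y; rewrite !iterS IHd raddfD. Qed.

Let iter0 d : iter d sigma 0 = 0.
Proof. by elim: d => [//|d IHd]; rewrite iterS IHd [LHS]raddf0. Qed.

Let iterZ d j x : iter d sigma (b j *: x) = b j *: iter d sigma x.
Proof. by elim: d => [//|d IHd]; rewrite !iterS IHd sigmaZ. Qed.

Let iterX d j x : iter (d + j) sigma (X ^+ j *: x) = iter d sigma x.
Proof.
elim: j x => [|j IHj] x; first by rewrite addn0 expr0 scale1r.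
by rewrite addnS iterSr exprS -scalerA sigmaK.
Qed.

Let iterU d x : U x -> U (iter d sigma x).
Proof. by move=> Ux; elim: d => [//|d IHd]; rewrite iterS; apply: sigmaU. Qed.

(* McCoy's argument: if the polynomial kills [x] modulo [U], then by induction
   on the degree of [x] each [b j] kills [x] modulo [U], the coefficients being
   treated from the top one down. *)
Lemma mccoy_regular : acyclic b U 0 -> regular_mod U (\sum_j b j * X ^+ j).
Proof.
move=> /acyclic0 acU x; set P := (\sum_j _) => UPx.
have [d dx] := sigma_nil x.
have {dx} : U (iter d sigma x) by rewrite dx; apply: submodule0.
elim: d x UPx => [//|d IHd] x UPx Udx; apply: acU => j.
have [n] := ubnP (m - j); elim: n j => [//|n IHn] j lt_n.
apply: IHd; first by rewrite scalerA mulrC -scalerA; apply: submoduleZ.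
(* In the shift by [d + j] of the product, the summand of index [j] becomes
   [iter d sigma (b j *: x)]. Those with [l < j] involve a further shift of [iter d.+1 sigma x],
   which is in [U]; those with [l > j] are in [U] by the inner induction. *)
have := iterU (d + j) UPx.
rewrite scaler_suml (big_morph _ (iter_add _) (iter0 _)).
rewrite (bigD1 j)//= mulrC -scalerA iterX; set S := \sum_(_ < _ | _) _.
suff US : U S by move=> /submoduleB/(_ US); rewrite addrK; apply.
apply: submodule_sum => // l nlj; rewrite -scalerA iterZ.
case: (ltngtP l j) nlj => [lt_lj _|lt_jl _|/ord_inj->]; last by rewrite eqxx.
  have -> : (d + j = j - l.+1 + d.+1 + l)%N.
    by rewrite addnS -addSn subnSK// addnAC subnK 1?addnC// ltnW.
  by apply: submoduleZ => //; rewrite iterX iterD; apply: iterU.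
rewrite -iterZ scalerA mulrC -scalerA; apply: iterU.
apply: submoduleZ => //; apply: IHn.
by apply: leq_trans (ltn_sub2l _ lt_jl) _.
Qed.

End McCoy.

(** * Division by a variable in polynomial rings *)

Section Shift.
Variables (A : comPzRingType) (n : nat).
Local Notation poly := (restr (mpzC A n)).
Local Notation monom := (@mpz_monom A n).
Implicit Types (c : A) (k : 'X_{1..n}) (p q : mpz A n) (u v : 'I_n).

Section LinearExtension.
Variables (V : zmodType) (h : 'X_{1..n} -> {additive A -> V}).

Definition mpz_lift (p : mpz A n) : V := \sum_(k <- msupp p) h k p@_k.

Lemma mpz_liftEw (d : {fset 'X_{1..n}}) p : (msupp p `<=` d)%fset ->
  mpz_lift p = \sum_(k <- d) h k p@_k.
Proof.
move=> le; rewrite [LHS](big_fset_incl _ le) => //= k _ /mcoeff_outdom ->.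
exact: raddf0.
Qed.

Lemma mpz_lift_monom c k : mpz_lift (monom c k) = h k c.
Proof.
rewrite (@mpz_liftEw [fset k]%fset) mpz_monom.unlock ?msuppU_le//.
by rewrite big_seq_fset1 mcoeffUU.
Qed.

Fact mpz_lift_is_zmod : zmod_morphism mpz_lift.
Proof.
move=> p q; set d := (msupp p `|` msupp q)%fset.
rewrite (@mpz_liftEw d) ?msuppB_le// (@mpz_liftEw d p) ?fsubsetUl//.
rewrite (@mpz_liftEw d q) ?fsubsetUr// -sumrB; apply/eq_bigr => k _.
by rewrite !raddfB.
Qed.

HB.instance Definition _ :=
  GRing.isZmodMorphism.Build (mpz A n) V mpz_lift mpz_lift_is_zmod.

End LinearExtension.

Definition monom_at k c : mpz A n := monom c k.

Fact monom_at_is_zmod k : zmod_morphism (monom_at k).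
Proof.
by move=> c c'; rewrite /monom_at mpz_monom.unlock; apply: monalgUB.
Qed.

HB.instance Definition _ k :=
  GRing.isZmodMorphism.Build A (mpz A n) (monom_at k) (monom_at_is_zmod k).

Definition mpzX v : mpz A n := monom 1 (ucm v).

Lemma monomM c k c' k' : monom c k * monom c' k' = monom (c * c') (mmul k k').
Proof. exact: mpz_mulUU. Qed.

Lemma mpzC_monom a c k : mpzC A n a * monom c k = monom (a * c) k.
Proof. by rewrite -[in RHS](mul1m k); apply: monomM. Qed.

(** Subtraction of exponents in [divcm] is truncated, so monomials free of [X_v] would be left
    unchanged; sending them to 0 makes the shift locally nilpotent. *)
Definition mpz_shift v : poly -> poly := mpz_lift (fun k =>
  if k v == 0%N then (\0 : {additive A -> mpz A n})
  else monom_at (divcm k (ucm v))).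

HB.instance Definition _ v := GRing.Additive.on (mpz_shift v).

Lemma mpz_shift_monom v c k : mpz_shift v (monom c k) =
  if k v == 0%N then 0 else monom c (divcm k (ucm v)).
Proof. by rewrite /mpz_shift mpz_lift_monom; case: ifP. Qed.

Lemma mpz_shiftX v p : mpz_shift v (mpzX v * p) = p.
Proof.
elim/mpz_ind: p => [c k|p q IHp IHq]; last by rewrite mulrDr raddfD /= IHp IHq.
rewrite monomM mul1r mpz_shift_monom cmM cmUU; congr (monom _ _).
by apply/eqP/cmP => u; rewrite divcmE cmM addKn.
Qed.

(** The case of interest is that of polynomials in which [X_v] does not occur. *)
Definition shift_linear v p := forall q, mpz_shift v (p * q) = p * mpz_shift v q.

Lemma shift_linearD v p q :
  shift_linear v p -> shift_linear v q -> shift_linear v (p + q).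
Proof. by move=> vp vq r; rewrite !mulrDl raddfD /= vp vq. Qed.

Lemma shift_linearM v p q :
  shift_linear v p -> shift_linear v q -> shift_linear v (p * q).
Proof. by move=> vp vq r; rewrite -!mulrA vp vq. Qed.

Lemma shift_linear_monom v c k : k v = 0%N -> shift_linear v (monom c k).
Proof.
move=> kv q; elim/mpz_ind: q => [c' k'|q r IHq IHr].
  rewrite monomM !mpz_shift_monom cmM kv add0n; case: eqP => [_|k'v].
    by rewrite mulr0.
  rewrite monomM; congr (monom _ _); apply/eqP/cmP => u.
  rewrite divcmE !cmM divcmE cmU; case: eqP => [<-|_]; last by rewrite !subn0.
  by rewrite kv !add0n.
by rewrite mulrDr !raddfD /= mulrDr IHq IHr.
Qed.

Lemma shift_linearC v c : shift_linear v (mpzC A n c).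
Proof. exact/shift_linear_monom/cm1. Qed.

Lemma shift_linearX v u : u != v -> shift_linear v (mpzX u).
Proof. by move=> /negPf uv; apply: shift_linear_monom; rewrite cmU uv. Qed.

Lemma shift_linear_sum v (J : Type) (s : seq J) (F : J -> mpz A n) :
  (forall j, shift_linear v (F j)) -> shift_linear v (\sum_(j <- s) F j).
Proof.
move=> vF; apply: big_ind => [q|q r|//]; last exact: shift_linearD.
by rewrite !mul0r raddf0.
Qed.

Lemma shift_linear_exp v p d : shift_linear v p -> shift_linear v (p ^+ d).
Proof.
move=> vp; elim: d => [|d IHd]; first by move=> q; rewrite !mul1r.
by rewrite exprS; apply: shift_linearM.
Qed.

Fact mpz_shift_is_scalable v : scalable (mpz_shift v).
Proof. by move=> a p; rewrite !restr_scaleE shift_linearC. Qed.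

HB.instance Definition _ v :=
  GRing.isScalable.Build A poly poly *:%R (mpz_shift v)
    (mpz_shift_is_scalable v).

Lemma mpz_shift_nil v (p : poly) : exists d, iter d (mpz_shift v) p = 0.
Proof.
have it0 d : iter d (mpz_shift v) 0 = 0.
  by elim: d => [//|d IHd]; rewrite iterS IHd [LHS]raddf0.
have itD d q r : iter d (mpz_shift v) (q + r) =
    iter d (mpz_shift v) q + iter d (mpz_shift v) r.
  by elim: d => [//|d IHd]; rewrite !iterS IHd raddfD.
elim/mpz_ind: p => [c k|q r [d qd] [e re]]; last first.
  by exists (d + e)%N; rewrite itD {1}addnC !iterD qd re !it0 addr0.
suff nil_monom d : forall k', k' v = d ->
    iter d.+1 (mpz_shift v) (monom c k') = 0.
  by exists (k v).+1; apply: nil_monom.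
elim: d {k} => [|d IHd] k kv.
  by rewrite /= mpz_shift_monom kv.
by rewrite iterSr mpz_shift_monom kv; apply: IHd; rewrite divcmE cmUU kv subn1.
Qed.

End Shift.

(** This form of [tensor_ind] keeps the type [base_change f M], on which [B] acts. *)
Lemma base_change_ind (A B : comPzRingType) (f : {rmorphism A -> B})
    (M : lmodType A) (P : base_change f M -> Prop) :
  P 0 -> (forall t u, P t -> P u -> P (t - u)) ->
  (forall m (c : restr f), P (tens m c)) -> forall t, P t.
Proof. exact: tensor_ind. Qed.

Section BaseChangeShift.
Variables (A : comPzRingType) (n : nat) (M : lmodType A).
Local Notation N := (base_change (mpzC A n) M).
Implicit Types (v : 'I_n) (t : N).

Definition base_change_shift v : N -> N := tensor_map idfun (@mpz_shift A n v).

HB.instance Definition _ v := GRing.Additive.on (base_change_shift v).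

Lemma base_change_shift_tens v m (q : restr (mpzC A n)) :
  base_change_shift v (tens m q) = tens m (mpz_shift v q).
Proof. exact: tensor_mapE. Qed.

Lemma base_change_shiftZ v p t : shift_linear v p ->
  base_change_shift v (p *: t) = p *: base_change_shift v t.
Proof.
move=> vp; elim/base_change_ind: t => [|t u IHt IHu|m q].
- by rewrite !(scaler0, raddf0).
- rewrite scalerBr raddfB /= [base_change_shift v (t - u)]raddfB /=.
  by rewrite scalerBr IHt IHu.
- have sE q' : p *: (tens m q' : N) = tens m (p * q' : restr (mpzC A n)).
    exact: base_change_scaleE.
  rewrite sE; apply: etrans (base_change_shift_tens _ _ _) _; rewrite vp -sE.
  by congr (_ *: _); apply/esym/base_change_shift_tens.
Qed.

Lemma base_change_shiftX v t : base_change_shift v (mpzX A v *: t) = t.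
Proof.
elim/base_change_ind: t => [|t u IHt IHu|m q].
- by rewrite !(scaler0, raddf0).
- by rewrite scalerBr raddfB /= IHt IHu.
- by rewrite base_change_scaleE base_change_shift_tens mpz_shiftX.
Qed.

Lemma base_change_shift_nil v t : exists d, iter d (base_change_shift v) t = 0.
Proof.
have it0 d : iter d (base_change_shift v) 0 = 0.
  by elim: d => [//|d IHd]; rewrite iterS IHd [LHS]raddf0.
have itB d t' u : iter d (base_change_shift v) (t' - u) =
    iter d (base_change_shift v) t' - iter d (base_change_shift v) u.
  by elim: d => [//|d IHd]; rewrite !iterS IHd raddfB.
elim/base_change_ind: t => [|t u [d td] [e ue]|m q].
- by exists 0%N.
- by exists (d + e)%N; rewrite itB {1}addnC !iterD td ue !it0 subr0.
have [d qd] := mpz_shift_nil v q; exists d.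
suff -> : iter d (base_change_shift v) (tens m q) =
    tens m (iter d (mpz_shift v) q).
  by rewrite qd tens0r.
elim: d {qd} => [//|d IHd]; rewrite !iterS IHd.
exact: base_change_shift_tens.
Qed.

End BaseChangeShift.

(** Each polynomial uses a variable [X_v] absent from the earlier ones. The shift along [X_v]
    therefore preserves the submodule generated by the earlier ones, and McCoy's argument applies
    modulo it. *)
Lemma polynomial_weak_sequence (A : comPzRingType) (n : nat) (M : lmodType A)
    (m : nat) (b : 'I_m -> A) (s : seq 'I_n) : uniq s ->
  (forall i, (i < size s)%N -> acyclic (mpzC A n \o b)
     [set 0 : base_change (mpzC A n) M] i) ->
  weak_sequence (base_change (mpzC A n) M)
    [seq \sum_j mpzC A n (b j) * mpzX A v ^+ j | v <- s].
Proof.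
move=> uniq_s ac; apply: (@acyclic_weak_sequence _ _ _ (mpzC A n \o b)); last first.
  by move=> i; rewrite size_map; apply: ac.
move=> i; rewrite size_map => lt_i.
have v0 : 'I_n by case: s lt_i {uniq_s ac}.
rewrite (nth_map v0)// -map_take; set v := nth _ _ _.
have vs : v \notin take i s.
  have := take_uniq i.+1 uniq_s.
  by rewrite (take_nth v0)// rcons_uniq => /andP[].
apply: (@mccoy_regular _ _ _ (mpzX A v) (base_change_shift v)).
- exact: submodule_seq_smul.
- move=> x.
  apply: (@seq_smul_min _ _ _ [set y | seq_smul _ _ (base_change_shift v y)]).
    have subV := submodule_seq_smul (base_change (mpzC A n) M)
      [seq \sum_j mpzC A n (b j) * mpzX A v ^+ j | v <- take i s].
    split=> [|y z] /=; first by rewrite raddf0; apply: submodule0.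
    by rewrite raddfB; apply: submoduleB.
  move=> r y /mapP[u us ->] /=; rewrite base_change_shiftZ.
    by apply: seq_smul_scale; apply: map_f.
  apply: shift_linear_sum => j; apply: shift_linearM; first exact: shift_linearC.
  apply/shift_linear_exp/shift_linearX; apply: contraNneq vs => <-.
  exact: us.
- exact: base_change_shiftX.
- by move=> j x; apply: base_change_shiftZ; apply: shift_linearC.
- exact: base_change_shift_nil.
Qed.

(** * Faithful flatness of polynomial rings *)

Section PolynomialFlatness.
Variables (A : comPzRingType) (n : nat).
Local Notation monom := (@mpz_monom A n).
Implicit Types (N : lmodType A) (k : 'X_{1..n}).

Lemma mcoeff_monom c k k' : (monom c k)@_k' = c *+ (k == k').
Proof. by rewrite mpz_monom.unlock; apply: mcoeffU. Qed.

Section Coefficients.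
Variable N : lmodType A.
Local Notation NX := (tensor N (restr (mpzC A n))).
Implicit Types (m : N) (t : NX) (p : restr (mpzC A n)).

Lemma mcoeff_scale a p k : (a *: p : mpz A n)@_k = a * (p : mpz A n)@_k.
Proof.
elim/mpz_ind: p => [c k'|p q IHp IHq]; last first.
  by rewrite scalerDr !mcoeffD IHp IHq mulrDr.
have -> : a *: (monom c k' : restr (mpzC A n)) = monom (a * c) k' :> mpz A n.
  exact: mpzC_monom.
by rewrite !mcoeff_monom mulrnAr.
Qed.

Definition tensor_coeff k : NX -> N :=
  tensor_lift (fun m p => (p : mpz A n)@_k *: m).

Let coeffDl k m m' p : (p : mpz A n)@_k *: (m + m') =
  (p : mpz A n)@_k *: m + (p : mpz A n)@_k *: m'.
Proof. exact: scalerDr. Qed.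

Let coeffDr k m p q : (p + q : mpz A n)@_k *: m =
  (p : mpz A n)@_k *: m + (q : mpz A n)@_k *: m.
Proof. by rewrite mcoeffD scalerDl. Qed.

Let coeffZ k a m p :
  (p : mpz A n)@_k *: (a *: m) = (a *: p : mpz A n)@_k *: m.
Proof. by rewrite scalerA mcoeff_scale mulrC. Qed.

Lemma tensor_coeffE k m p : tensor_coeff k (tens m p) = (p : mpz A n)@_k *: m.
Proof. exact: (tensor_liftE (@coeffDl k) (@coeffDr k) (@coeffZ k)). Qed.

Fact tensor_coeff_is_zmod k : zmod_morphism (tensor_coeff k).
Proof. exact: (tensor_lift_is_zmod (@coeffDl k) (@coeffDr k) (@coeffZ k)). Qed.

HB.instance Definition _ k :=
  GRing.isZmodMorphism.Build NX N (tensor_coeff k) (tensor_coeff_is_zmod k).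

Definition tensor_monom k m : NX := tens m (monom 1 k : restr (mpzC A n)).

Lemma tensor_monomK k m : tensor_coeff k (tensor_monom k m) = m.
Proof. by rewrite tensor_coeffE mcoeff_monom eqxx scale1r. Qed.

Fact tensor_monom_is_zmod k : zmod_morphism (tensor_monom k).
Proof. by move=> m m'; apply: tensBl. Qed.

HB.instance Definition _ k :=
  GRing.isZmodMorphism.Build N NX (tensor_monom k) (tensor_monom_is_zmod k).

(** With [tensor_monomK], this exhibits [N[X_1, ..., X_n]] as sums of monomials with coefficients in
    [N]. *)
Lemma tensor_coeff_sum t : exists d : {fset 'X_{1..n}},
  t = \sum_(k <- d) tensor_monom k (tensor_coeff k t).
Proof.
(* Allowing every larger index set lets the sets of two tensors be merged in the inductive step. *)
suff [d dt] : exists d : {fset 'X_{1..n}}, forall d', (d `<=` d')%fset ->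
    t = \sum_(k <- d') tensor_monom k (tensor_coeff k t).
  by exists d; apply: dt.
elim/tensor_ind: t => [|t u [d dt] [e eu]|m p].
- by exists fset0 => d' _; rewrite big1// => k _; rewrite !raddf0.
- exists (d `|` e)%fset => d'; rewrite fsubUset => /andP[/dt dt' /eu eu'].
  rewrite [in LHS]dt' [in LHS]eu' -sumrB; apply: eq_bigr => k _.
  by rewrite !raddfB.
exists (msupp (p : mpz A n)) => d' le_d.
have pE : p = \sum_(k <- d')
    (monom (p : mpz A n)@_k k : restr (mpzC A n)) :> restr (mpzC A n).
  by rewrite mpz_monom.unlock; apply: monalgEw.
rewrite [in LHS]pE (big_morph (tens m) (tensDr m) (tens0r _ m)).
apply: eq_bigr => k _; rewrite tensor_coeffE.
apply: etrans (esym (tens_balanced _ _ _)); congr tens; apply: esym.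
by apply: etrans (mpzC_monom _ _ _) _; rewrite mulr1.
Qed.

End Coefficients.

Section Naturality.
Variables (N N' : lmodType A) (g : {linear N -> N'}).

Local Notation gX := (tensor_map g (idfun : {linear restr (mpzC A n) -> _})).

Lemma tensor_coeff_map k t : tensor_coeff k (gX t) = g (tensor_coeff k t).
Proof.
elim/tensor_ind: t => [|t u IHt IHu|m p]; first by rewrite !raddf0.
  by rewrite !raddfB /= IHt IHu.
by rewrite tensor_mapE !tensor_coeffE linearZ.
Qed.

Lemma tensor_monom_map k m : gX (tensor_monom k m) = tensor_monom k (g m).
Proof. exact: tensor_mapE. Qed.

End Naturality.

(** Extended maps act coefficientwise: preimages are chosen one coefficient at a time, and exactness
    descends by looking at constant terms. *)
Lemma mpzC_faithfully_flat : faithfully_flat (mpzC A n).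
Proof.
move=> N1 N2 N3 g h; split=> ex y.
  split=> [hy|[x <-]].
    have /choice[x gx] k : exists x, g x = tensor_coeff k y.
      by apply/ex; rewrite -tensor_coeff_map hy raddf0.
    have [d dy] := tensor_coeff_sum y.
    exists (\sum_(k <- d) tensor_monom k (x k)); rewrite raddf_sum [RHS]dy.
    by apply: eq_bigr => k _; rewrite -gx; apply: tensor_monom_map.
  have [d ->] := tensor_coeff_sum x.
  rewrite (raddf_sum (tensor_map g idfun)) (raddf_sum (tensor_map h idfun)).
  apply: big1 => k _.
  apply: etrans (congr1 (tensor_map h idfun) (tensor_monom_map _ _ _)) _.
  apply: etrans (tensor_monom_map _ _ _) _; rewrite (_ : h _ = 0) ?raddf0//.
  by apply/ex; exists (tensor_coeff k x).
split=> [hy|[x <-]].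
  have [t gt] : exists t, tensor_map g idfun t = tensor_monom mone y.
    by apply/ex; rewrite tensor_monom_map hy raddf0.
  by exists (tensor_coeff mone t); rewrite -tensor_coeff_map gt tensor_monomK.
rewrite -[LHS](tensor_monomK mone) -tensor_monom_map -tensor_monom_map.
rewrite (_ : tensor_map h _ _ = 0) ?raddf0//.
by apply/ex; exists (tensor_monom mone x).
Qed.

End PolynomialFlatness.

(** * Finite generation and transfer of weak sequences *)

Lemma ideal_sum (R : comPzRingType) (J : set R) (I : Type) (s : seq I)
  (F : I -> R) : is_ideal J -> (forall i, J (F i)) -> J (\sum_(i <- s) F i).
Proof. by case=> J0 JD _ JF; apply: (big_ind J). Qed.

Lemma ideal_span_sub (R : comPzRingType) (S S' : set R) :
  S `<=` S' -> ideal_span S `<=` ideal_span S'.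
Proof. by move=> SS' x Sx J HJ S'J; apply: Sx => // y /SS'/S'J. Qed.

Lemma ext_ideal_fg (A B : comPzRingType) (f : {rmorphism A -> B}) (I : set A)
    (rs : seq B) : {in rs, forall r, ext_ideal f I r} ->
  exists bs : seq A, {in bs, forall a, I a} /\
    {in rs, forall r, ideal_span [set` map f bs] r}.
Proof.
have cat_sub (bs bs' : seq A) :
    [set` map f bs] `<=` [set` map f (bs ++ bs')] /\
    [set` map f bs'] `<=` [set` map f (bs ++ bs')].
  by split=> r /=; rewrite map_cat mem_cat => ->; rewrite ?orbT.
have catI (bs bs' : seq A) : {in bs, forall a, I a} -> {in bs', forall a, I a} ->
    {in bs ++ bs', forall a, I a}.
  by move=> Ibs Ibs' a; rewrite mem_cat => /orP[/Ibs|/Ibs'].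
have fg1 r : ext_ideal f I r -> exists bs : seq A,
    {in bs, forall a, I a} /\ ideal_span [set` map f bs] r.
  move=> Jr; apply: (Jr [set x | exists bs : seq A,
    {in bs, forall a, I a} /\ ideal_span [set` map f bs] x]).
  split=> /= [|x y [bs [Ibs Jx]] [bs' [Ibs' Jy]]|a x [bs [Ibs Jx]]].
  - by exists [::]; split=> //; have [] := ideal_span_is_ideal [set` map f [::]].
  - exists (bs ++ bs'); split; first exact: catI.
    have [_ JD _] := ideal_span_is_ideal [set` map f (bs ++ bs')].
    by have [s s'] := cat_sub bs bs'; apply: JD; [move: Jx|move: Jy];
      apply: ideal_span_sub.
  - exists bs; split=> //; have [_ _ JM] := ideal_span_is_ideal [set` map f bs].
    exact: JM.
  move=> _ [a Ia <-]; exists [:: a]; split=> [_ /[!inE]/eqP -> //|J _].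
  by apply; rewrite /= inE.
elim: rs => [|r rs IHrs] Jrs; first by exists [::].
have [|bs [Ibs Jbs]] := IHrs.
  by move=> s srs; apply: Jrs; rewrite inE srs orbT.
have [bs' [Ibs' Jr]] := fg1 r (Jrs r (mem_head _ _)).
have [s s'] := cat_sub bs bs'; exists (bs ++ bs'); split; first exact: catI.
move=> t; rewrite inE => /predU1P[->|/Jbs]; last exact: ideal_span_sub.
exact: ideal_span_sub Jr.
Qed.

(** Cohomological vanishing descends along [f] from [base_change f M] to [M] and then ascends along
    [mpzC A n]. One variable is spent on each element, hence the bound on [size rs]. *)
Lemma polynomial_grade_ge (A B : comPzRingType) (f : {rmorphism A -> B})
    (I : set A) (M : lmodType A) (rs : seq B) (n : nat) :
  faithfully_flat f -> weak_sequence (base_change f M) rs ->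
  {in rs, forall r, ext_ideal f I r} -> (size rs <= n)%N ->
  exists rs' : seq (mpz A n),
    [/\ size rs' = size rs, weak_sequence (base_change (mpzC A n) M) rs' &
        {in rs', forall r, ext_ideal (mpzC A n) I r}].
Proof.
move=> flatf wrs /ext_ideal_fg[bs [Ibs Jrs]] le_n.
pose b (j : 'I_(size bs)) := bs`_j; pose s := take (size rs) (enum 'I_n).
have size_s : size s = size rs by rewrite size_takel// size_enum_ord.
exists [seq \sum_j mpzC A n (b j) * mpzX A v ^+ j | v <- s]; split.
- by rewrite size_map.
- apply: polynomial_weak_sequence => [|i]; first exact/take_uniq/enum_uniq.
  rewrite size_s => lt_i.
  apply/(acyclic_base_change _ _ _ (@mpzC_faithfully_flat A n)).
  apply/(acyclic_base_change _ _ _ flatf).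
  apply/(weak_sequence_acyclic wrs) => // r /Jrs.
  apply: ideal_span_sub => _ /mapP[a abs ->].
  exists (Ordinal (etrans (index_mem a bs) abs)) => //=.
  by rewrite /b /= nth_index.
- have idI := ideal_span_is_ideal (mpzC A n @` I).
  move=> _ /mapP[v _ ->]; apply: (ideal_sum _ idI) => j; have [_ _ JM] := idI.
  rewrite mulrC; apply: JM => J _; apply; exists (b j) => //.
  by apply: Ibs; apply: mem_nth.
Qed.

(** * Grades *)

(* Both the limit and the supremum are taken in the extended reals over an
   arbitrary [K : realType]. *)
Theorem theorem3p14 (K : realType) (A : comPzRingType) (I : set A)
    (M : lmodType A) (hI : is_ideal I) :
  (fun n : nat => grade (base_change (mpzC A n) M) K (ext_ideal (mpzC A n) I))
    @ \oo -->
  ereal_sup [set g : \bar K | exists (B : comPzRingType) (f : {rmorphism A -> B}),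
    faithfully_flat f /\ g = grade (base_change f M) K (ext_ideal f I)].
Proof.
set S := ereal_sup _; set g := fun n => _.
pose attained k :=
  exists (B : comPzRingType) (f : {rmorphism A -> B}) (rs : seq B),
  [/\ faithfully_flat f, weak_sequence (base_change f M) rs,
      {in rs, forall r, ext_ideal f I r} & size rs = k].
(* Truncating the attained lengths at [n] makes [h] nondecreasing by construction, with supremum
   [S]. As [h n <= g n <= S], the convergence of [g] follows by squeezing, without comparing
   successive values of [g]. *)
pose h n : \bar K :=
  ereal_sup [set k%:R%:E | k in [set k | attained k /\ (k <= n)%N]].
have hg n : (h n <= g n)%E.
  apply: ge_ereal_sup => _ [k [[B [f [rs [flatf wrs Irs <-]]]] le_n] <-].
  have [rs' [size_rs' wrs' Irs']] := polynomial_grade_ge flatf wrs Irs le_n.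
  by apply: ereal_sup_ubound; exists rs'; rewrite ?size_rs'.
have gS n : (g n <= S)%E.
  apply: ereal_sup_ubound; exists (mpz A n), (mpzC A n).
  by split=> //; apply: mpzC_faithfully_flat.
have SE : S = ereal_sup (range h).
  apply/eqP; rewrite eq_le; apply/andP; split; apply: ge_ereal_sup.
    move=> _ [B [f [flatf ->]]]; apply: ge_ereal_sup => _ [rs [wrs Irs] <-].
    apply: (@le_trans _ _ (h (size rs))); apply: ereal_sup_ubound; last by exists (size rs).
    by exists (size rs) => //; split=> //; exists B, f, rs.
  by move=> _ [n _ <-]; apply: le_trans (hg n) (gS n).
have h_cvg : h @ \oo --> ereal_sup (range h).
  apply: ereal_nondecreasing_cvgn => n n' le_n; apply: le_ereal_sup.
  by move=> _ [k [attk le_k] <-]; exists k => //; split=> //; apply: leq_trans le_n.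
rewrite SE; apply: (squeeze_cvge _ h_cvg (cvg_cst (ereal_sup (range h)))).
by apply: nearW => n; rewrite hg -SE gS.
Qed.
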